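(* Let $1<q<p$. For $s\in(0,1)$ put $$h(s)=\frac{\left(\frac{p-q}{q}\,a(s)+\frac1s\right)^{p}}{\left(\frac{p}{q}\,a(s)+1\right)^{p-q}},\qquad a(s)=\frac{\omega_q(s)^q}{s}-1 .$$ Then $h$ is strictly decreasing on $(0,1)$, for every $s_1\in(0,1)$ there is a unique $s\in(0,1)$, denoted $h^{-1}\!\left(1/s_1^{q}\right)$, with $h(s)=1/s_1^{q}$, and for every $(s_1,s_2)\in D$ $$t_{s_1,s_2}'(0)<0\quad\Longleftrightarrow\quad s_2>h^{-1}\!\left(\frac{1}{s_1^{q}}\right).$$
   Context: For $r>1$ let $H_r(z)=r z^{r-1}-(r-1)z^{r}$. It is strictly decreasing from $[1,\frac{r}{r-1}]$ onto $[0,1]$, and $\omega_r:[0,1]\to[1,\frac{r}{r-1}]$ denotes its inverse function. $D=\{(s_1,s_2)\in\mathbb{R}^2:\ 0<s_1^{q-1}\le s_2^{p-1}<1\}$. For $(s_1,s_2)\in D$, $t(0)=t_{s_1,s_2}(0)$ is the unique real number $t(0)\ge 1$ satisfying $$t(0)^{p}-\frac{p}{p-q}\,t(0)^{p-q}=s_1-\frac{p}{p-q}\,\frac{s_1}{s_2}.$$ (The function $y\mapsto y^p-\frac{p}{p-q}y^{p-q}$ is strictly increasing on $[1,\infty)$ with value $-\frac{q}{p-q}$ at $1$.) The number $t(0)$ is the value at $\beta=0$ of a function $\beta\mapsto t_{s_1,s_2}(\beta)$, $\beta\in[0,\frac1{p-1}]$. Only the sign of its derivative $t_{s_1,s_2}'(0)$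 at $\beta=0$ enters the claim, and this sign is specified as follows: $t_{s_1,s_2}'(0)$ is negative, zero or positive according as $$-q\,t(0)^{p-q}-(p-q)s_1+\frac{s_1}{s_2}\Big[(p-q)\,\omega_q(s_2)^{q}+q\Big]$$ is negative, zero or positive. Equivalently, $t_{s_1,s_2}'(0)<0$ means $t(0)^{p-q}>\frac{p-q}{q}\,s_1\,a(s_2)+\frac{s_1}{s_2}$. *)

(* Defs.v *)
From mathcomp Require Import all_boot all_order all_algebra.
From mathcomp Require Import all_classical all_reals all_analysis.

Set Implicit Arguments.
Unset Strict Implicit.
Unset Printing Implicit Defensive.

Import Order.TTheory GRing.Theory Num.Theory.
Import numFieldNormedType.Exports.

Local Open Scope classical_set_scope.
Local Open Scope ring_scope.

Section Defs.
Context {R : realType}.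
Implicit Types (p q r s y z : R).

Definition H r z : R := r * z `^ (r - 1) - (r - 1) * z `^ r.

(* The inverse of [H r] restricted to [1, r/(r-1)]; only its values on [0, 1],
   the image of that interval when 1 < r, are meaningful. *)
Definition omega r : R -> R := 'pinv_(fun=> 1) `[1, r / (r - 1)] (H r).

Definition a q s : R := omega q s `^ q / s - 1.

Definition h p q s : R :=
  ((p - q) / q * a q s + s^-1) `^ p / (p / q * a q s + 1) `^ (p - q).

(* The inverse of [h p q] restricted to (0, 1). *)
Definition hinv p q : R -> R := 'pinv_(fun=> 1) `]0, 1[ (h p q).

(* The positivity of both coordinates, implicit in the use of real powers, is
   spelled out because [powR] is total. *)
Definition D p q : set (R * R) :=
  [set s | [/\ 0 < s.1, 0 < s.2, 0 < s.1 `^ (q - 1),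
               s.1 `^ (q - 1) <= s.2 `^ (p - 1) & s.2 `^ (p - 1) < 1]].

Definition t0 p q (s1 s2 : R) : R :=
  xget 1 [set y | 1 <= y /\
    y `^ p - p / (p - q) * y `^ (p - q) = s1 - p / (p - q) * (s1 / s2)].

Definition t0_slope_sign p q (s1 s2 : R) : R :=
  Num.sg (- q * t0 p q s1 s2 `^ (p - q) - (p - q) * s1
          + s1 / s2 * ((p - q) * omega q s2 `^ q + q)).

(* One-sided, since the functions beta |-> t(beta) start at beta = 0. *)
Definition diffquot0 (f : R -> R) (e : R) : R := (f e - f 0) / e.
Definition rderivable0 (f : R -> R) : Prop := cvg (diffquot0 f e @[e --> 0^'+]).
Definition rderive0 (f : R -> R) : R := lim (diffquot0 f e @[e --> 0^'+]).

(* All that is known of beta |-> t_{s1,s2}(beta): its value at 0 and the sign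
   of its derivative there. *)
Definition is_t p q (s1 s2 : R) (t : R -> R) : Prop :=
  [/\ t 0 = t0 p q s1 s2, rderivable0 t &
      Num.sg (rderive0 t) = t0_slope_sign p q s1 s2].

End Defs.

(* Main.v *)
Require Import Defs.
From mathcomp Require Import all_boot all_order all_algebra.
From mathcomp Require Import all_classical all_reals all_analysis.
From mathcomp Require Import ring lra.
Set Implicit Arguments.
Unset Strict Implicit.
Unset Printing Implicit Defensive.
Import Order.TTheory GRing.Theory Num.Theory.
Import numFieldNormedType.Exports.
Local Open Scope classical_set_scope.
Local Open Scope ring_scope.

(** Everything becomes explicit in the parameter [w = omega q s]. Write
    [c = p - q], [k = q - 1], [x = w - 1]. Since [s = H q w = w^k (q - k w)],
    the function [h] takes the form [A^p / (G^q B^c)] with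
    [A = c x + w^(1-q)], [B = c x + w] and [G = q - k w = 1 - k x] (these are
    [hnum], [hden] and [hgap]). As [s] increases from 0 to 1, [w] decreases from [q/(q-1)] to 1, so [h] is
    decreasing as soon as [p ln A - q ln G - c ln B] increases with [w]. The
    derivative of the latter, multiplied by [A B G], is affine in
    [u = w^(-q)], and its values at [u = 0] and [u = 1] are the polynomials
    [c^2 G + q c B] and [k q p x + x^2 (c k (k c + p) + k q^2 (c + 1))], both
    positive ([derive_lnh_par_gt0]). At [w = 1] the value of [h] is 1, and near
    [w = q/(q-1)] the factor [G^q] makes [h] arbitrarily large, so every level
    above 1 is attained ([h_surj]).

    For the equivalence, put [T = t(0)], [A' = (c/q) a(s2) + 1/s2] and
    [B' = (p/q) a(s2) + 1], so that [h(s2) = A'^p / B'^c]; the condition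
    [t'(0) < 0] reads [T^c > s1 A']. If [s1 A' >= 1], write [s1 A' = z^c] with
    [z >= 1] and apply to [T] and [z] the function [y^p - (p/c) y^c], which is
    increasing for [y >= 1]. Its value at [T] is prescribed by the definition
    of [t(0)], and after simplification [T > z] becomes [z^p < s1 B'], that is
    [(s1 A')^p < (s1 B')^c], that is [h(s2) < 1/s1^q]. If [s1 A' < 1], both
    sides hold: [T^c >= 1 > s1 A'], and [(s1 A')^p < (s1 A')^c <= (s1 B')^c]
    because [A' <= B'] ([t0_gt_iff]). That [(s1, s2)] lies in [D] ensures the
    existence of [t(0)], which amounts to [p s1 / s2 <= c s1 + q]; this comes
    from Young's inequality ([D_bound]). *)

(** * Monotonicity and intermediate values *)

Section Calculus.
Context {R : realType}.
Implicit Types (f df : R -> R) (a b x y z r v : R).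

(** The derivative may vanish at the end points: this is what happens to [H]
    and to the function defining [t(0)] at 1. *)
Lemma is_derive_lt f df a b : a < b ->
  (forall x, a <= x <= b -> is_derive x 1 f (df x)) ->
  (forall x, a < x < b -> 0 < df x) -> f a < f b.
Proof.
move=> ab fdf df_gt0.
have [||c cab fab] := @MVT R f df a b ab.
- by move=> x; rewrite in_itv/= => /andP[/ltW ax /ltW xb]; apply: fdf; rewrite ax.
- apply: derivable_within_continuous => x; rewrite in_itv/= => /fdf xab.
  exact: ex_derive.
move: cab; rewrite in_itv/= => cab.
by rewrite -subr_gt0 fab mulr_gt0 ?subr_gt0 ?df_gt0.
Qed.

Lemma IVT_le f a b v : a <= b ->
  (forall x, a <= x <= b -> {for x, continuous f}) ->
  f a <= v <= f b \/ f b <= v <= f a ->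
  exists2 x, a <= x <= b & f x = v.
Proof.
move=> ab cf fab.
have [||x] := @IVT R f a b v ab.
- apply: continuous_in_subspaceT => x /[1!inE]; rewrite /= in_itv/=; exact: cf.
- rewrite ge_min le_max.
  by case: fab => /andP[-> ->]; rewrite ?orbT.
by rewrite in_itv/= => xab fx; exists x.
Qed.

End Calculus.

(** * The function [H] and its inverse *)

Section Omega.
Context {R : realType}.
Implicit Types (q s w z : R).

Lemma H1 q : H q 1 = 1.
Proof. by rewrite /H !powR1; ring. Qed.

Lemma H_factor q w : 0 < q -> 0 < w -> H q w = w `^ (q - 1) * (q - (q - 1) * w).
Proof.
by move=> q0 w0; rewrite /H -(mulr_powRB1 (ltW w0) q0); ring.
Qed.

Lemma is_derive_H q w : 0 < w ->
  is_derive w 1 (H q) (q * (q - 1) * (w `^ (q - 2) * (1 - w))).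
Proof.
move=> w0.
have d1 := is_derive1_powR (q - 1) w0; have d2 := is_derive1_powR q w0.
have := is_deriveB (is_deriveZ q d1) (is_deriveZ (q - 1) d2).
move=> /is_derive_eq; apply.
have -> : q - 1 - 1 = q - 2 by ring.
have -> : w `^ (q - 1) = w `^ (q - 2) * w.
  rewrite (_ : q - 1 = q - 2 + 1); last by ring.
  by rewrite powRD ?powRr1 ?ltW// (gt_eqF w0) implybT.
by rewrite /GRing.scale/=; ring.
Qed.

Lemma H_decr q w z : 1 < q -> 1 <= w -> w < z -> H q z < H q w.
Proof.
move=> q1 w1 wz; rewrite -ltrN2.
apply: (@is_derive_lt _ (fun x => - H q x)
  (fun x => - (q * (q - 1) * (x `^ (q - 2) * (1 - x))))) => // x /andP[wx xz].
  by apply: is_deriveN; apply: is_derive_H; lra.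
have P0 : 0 < x `^ (q - 2) by apply: powR_gt0; lra.
by rewrite -!mulrN opprB; apply: mulr_gt0; apply: mulr_gt0 => //; lra.
Qed.

Lemma HK q w : 1 < q -> 1 <= w <= q / (q - 1) -> omega q (H q w) = w.
Proof.
move=> q1 w1; rewrite /omega pinvKV//; last by rewrite inE/= in_itv.
move=> x y; rewrite !inE/= !in_itv/= => /andP[x1 _] /andP[y1 _] xy.
by apply/eqP; case: ltgtP => // /(H_decr q1); rewrite xy ltxx; apply.
Qed.

Lemma omegaP q s : 1 < q -> 0 < s < 1 ->
  1 < omega q s < q / (q - 1) /\ H q (omega q s) = s.
Proof.
move=> q1 s01.
have w0gt1 : 1 < q / (q - 1) by rewrite ltr_pdivlMr; lra.
have Hw0 : H q (q / (q - 1)) = 0.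
  rewrite H_factor; [|lra|lra]; rewrite [_ * (q / _)]mulrC divfK ?subrr ?mulr0//.
  by rewrite gt_eqF//; lra.
have [||w w1 Hw] := @IVT_le _ (H q) 1 (q / (q - 1)) s (ltW w0gt1).
- move=> x /andP[x1 _]; apply/differentiable_continuous/derivable1_diffP.
  by apply: ex_derive; apply: is_derive_H; lra.
- by right; rewrite Hw0 H1; lra.
rewrite -Hw HK//; split => //.
case/andP: w1 => w1 ww0; rewrite !lt_neqAle w1 ww0 !andbT.
apply/andP; split; apply/eqP => we; move: Hw.
  by rewrite -we H1; lra.
by rewrite we Hw0; lra.
Qed.

Lemma omega_decr q s z : 1 < q -> 0 < s -> s < z -> z < 1 ->
  omega q z < omega q s.
Proof.
move=> q1 s0 sz z1.
have [|/andP[ws1 _] Hs] := omegaP q1 (_ : 0 < s < 1); first by lra.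
have [|/andP[wz1 _] Hz] := omegaP q1 (_ : 0 < z < 1); first by lra.
rewrite ltNge le_eqVlt; apply/negP => /orP[/eqP sz'|/(H_decr q1 (ltW ws1))].
  by move: sz; rewrite -Hs -Hz sz' ltxx.
by rewrite Hs Hz ltNge (ltW sz).
Qed.

End Omega.

(** * The function [h] in the parameter [w = omega q s] *)

Section HOfOmega.
Context {R : realType}.
Implicit Types (p q s w z y : R).

(** With [w = omega q s], both bases of the powers in [h] share the denominator
    [hgap q w]; their numerators are [hnum p q w] and [hden p q w]. *)
Definition hnum p q w : R := (p - q) * (w - 1) + w `^ (1 - q).
Definition hden p q w : R := (p - q) * (w - 1) + w.
Definition hgap q w : R := q - (q - 1) * w.
(** Taking logarithms merges the powers [p] and [p - q] of the common
    denominator into the single coefficient [- q]. *)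
Definition lnh_par p q w : R :=
  p * ln (hnum p q w) - q * ln (hgap q w) - (p - q) * ln (hden p q w).

Lemma hnum_hden_hgap_gt0 p q w : 1 < q -> q < p ->
  1 <= w < q / (q - 1) -> [/\ 0 < hnum p q w, 0 < hden p q w & 0 < hgap q w].
Proof.
move=> q1 qp /andP[w1]; rewrite ltr_pdivlMr; last by lra.
move=> wq; have w0 : 0 < w `^ (1 - q) by apply: powR_gt0; lra.
have cw : 0 <= (p - q) * (w - 1) by rewrite mulr_ge0; lra.
by rewrite /hnum /hden /hgap; split; lra.
Qed.

Lemma coef_omega p q s (w := omega q s) : 1 < q -> q < p ->
  0 < s < 1 ->
  (p - q) / q * a q s + s^-1 = hnum p q w / hgap q w /\
  p / q * a q s + 1 = hden p q w / hgap q w.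
Proof.
move=> q1 qp s01; have [/andP[w1 wq] Hw] := omegaP q1 s01; rewrite -/w in w1 wq Hw.
have [A0 B0 d0] : [/\ 0 < hnum p q w, 0 < hden p q w & 0 < hgap q w].
  by apply: hnum_hden_hgap_gt0 => //; rewrite ltW.
have w0 : 0 < w by lra.
have k0 : 0 < w `^ (q - 1) by apply: powR_gt0.
have es : s = w `^ (q - 1) * hgap q w by rewrite -Hw H_factor//; lra.
have ea : a q s = q * (w - 1) / hgap q w.
  rewrite /a -/w es -(@mulr_powRB1 _ w q) ?ltW//; last by lra.
  by rewrite /hgap; field; rewrite -/(hgap q w) !gt_eqF.
have eN : w `^ (1 - q) = (w `^ (q - 1))^-1.
  by rewrite -powRN; congr (_ `^ _); ring.
rewrite ea es /hnum /hden eN; split; rewrite /hgap; field.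
  by rewrite -/(hgap q w) !gt_eqF//; lra.
by rewrite -/(hgap q w) !gt_eqF//; lra.
Qed.

Lemma ln_h_omega p q s : 1 < q -> q < p ->
  0 < s < 1 -> 0 < h p q s /\ ln (h p q s) = lnh_par p q (omega q s).
Proof.
move=> q1 qp s01; have [/andP[w1 wq] _] := omegaP q1 s01.
have [A0 B0 d0] : [/\ 0 < hnum p q (omega q s), 0 < hden p q (omega q s)
    & 0 < hgap q (omega q s)].
  by apply: hnum_hden_hgap_gt0 => //; rewrite ltW.
have [eA eB] := coef_omega q1 qp s01; rewrite /h eA eB.
have Ad0 := divr_gt0 A0 d0; have Bd0 := divr_gt0 B0 d0.
split; first by rewrite divr_gt0 ?powR_gt0.
rewrite ln_div ?posrE ?powR_gt0// !ln_powR !ln_div ?posrE// /lnh_par; ring.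
Qed.

Lemma is_derive_lnh_par p q w : 1 < q -> q < p ->
  1 <= w < q / (q - 1) -> is_derive w 1 (lnh_par p q)
  (p * (((p - q) + (1 - q) * w `^ (- q)) / hnum p q w)
   + q * ((q - 1) / hgap q w)
   - (p - q) * ((p - q + 1) / hden p q w)).
Proof.
move=> q1 qp w1q; have [A0 B0 d0] := hnum_hden_hgap_gt0 q1 qp w1q.
have w0 : 0 < w by case/andP: w1q; lra.
have dw := is_derive_id w (1 : R).
have dp := is_derive1_powR (1 - q) w0.
have dlin (c : R) : is_derive w 1 (fun x => c * (x - 1)) c.
  apply: (is_derive_eq (is_deriveZ c (is_deriveB dw (is_derive_cst (1 : R) w 1)))).
  by rewrite subr0 /GRing.scale/= mulr1.
have dA : is_derive w 1 (hnum p q) ((p - q) + (1 - q) * w `^ (- q)).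
  apply: (is_derive_eq (is_deriveD (dlin _) dp)).
  by rewrite (_ : 1 - q - 1 = - q)//; ring.
have dB : is_derive w 1 (hden p q) (p - q + 1) by exact: is_deriveD (dlin _) dw.
have dd : is_derive w 1 (hgap q) (- (q - 1)).
  apply: (is_derive_eq (is_deriveB (is_derive_cst q w 1) (is_deriveZ (q - 1) dw))).
  by rewrite sub0r /GRing.scale/= mulr1.
have lnA := @is_derive1_comp _ _ _ _ _ _ (is_derive1_ln A0) dA.
have lnB := @is_derive1_comp _ _ _ _ _ _ (is_derive1_ln B0) dB.
have lnd := @is_derive1_comp _ _ _ _ _ _ (is_derive1_ln d0) dd.
have := is_deriveB (is_deriveB (is_deriveZ p lnA) (is_deriveZ q lnd))
  (is_deriveZ (p - q) lnB).
by move=> /is_derive_eq; apply; rewrite /GRing.scale/=; ring.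
Qed.

(** Over the common denominator [hnum * hden * hgap] the numerator is affine in
    [u = w `^ (- q)], which lies in [0, 1]. It is therefore the convex
    combination, with weights [1 - u] and [u], of two polynomials whose
    positivity is visible. The second one vanishes at [w = 1], where [u = 1],
    so the monotonicity degenerates there. *)
Lemma derive_lnh_par_gt0 p q w : 1 < q -> q < p ->
  1 < w < q / (q - 1) ->
  0 < p * (((p - q) + (1 - q) * w `^ (- q)) / hnum p q w)
   + q * ((q - 1) / hgap q w)
   - (p - q) * ((p - q + 1) / hden p q w).
Proof.
move=> q1 qp w1q; have [A0 B0 d0] : [/\ 0 < hnum p q w, 0 < hden p q w & 0 < hgap q w].
  by apply: hnum_hden_hgap_gt0 => //; case/andP: w1q => /ltW ->.
have w0 : 0 < w by case/andP: w1q; lra.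
set u := w `^ (- q).
have u0 : 0 < u by rewrite powR_gt0.
have u1 : u <= 1.
  rewrite /u powRN invf_le1 ?powR_gt0// -(powRr0 w) ler_powR//; last by lra.
  by case/andP: w1q; lra.
have eA : hnum p q w = (p - q) * (w - 1) + w * u.
  by rewrite /hnum powRD ?powRr1 ?ltW// (gt_eqF w0) implybT.
pose x := w - 1; have x0 : 0 < x by case/andP: w1q; rewrite /x; lra.
pose c := p - q; have c0 : 0 < c by rewrite /c; lra.
pose k := q - 1; have k0 : 0 < k by rewrite /k; lra.
pose N := (1 - u) * (c ^+ 2 * hgap q w + q * c * hden p q w)
  + u * (k * q * p * x + x ^+ 2 * (c * k * (k * c + p) + k * q ^+ 2 * (c + 1))).
have N0 : 0 < N.
  have p0 : 0 < p by lra.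
  have q0 : 0 < q by lra.
  apply: ltr_wpDl.
    rewrite mulr_ge0 ?subr_ge0// ltW//.
    by do !first [done | apply: addr_gt0 | apply: mulr_gt0 | apply: exprn_gt0].
  by do !first [done | apply: addr_gt0 | apply: mulr_gt0 | apply: exprn_gt0].
rewrite (_ : _ - _ = N / (hnum p q w * hden p q w * hgap q w)).
  by rewrite divr_gt0 ?mulr_gt0.
rewrite /N /x /c /k eA /hden /hgap; field.
by rewrite -/(hgap q w) -/(hden p q w) -eA !gt_eqF.
Qed.

Lemma lnh_par_incr p q w z : 1 < q -> q < p ->
  1 <= w -> w < z -> z < q / (q - 1) -> lnh_par p q w < lnh_par p q z.
Proof.
move=> q1 qp w1 wz zq; apply: (is_derive_lt wz).
  by move=> x /andP[wx xz]; apply: is_derive_lnh_par; lra.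
by move=> x /andP[wx xz]; apply: derive_lnh_par_gt0; lra.
Qed.

Lemma h_decr p q s z : 1 < q -> q < p ->
  0 < s -> s < z -> z < 1 -> h p q z < h p q s.
Proof.
move=> q1 qp s0 sz z1.
have [|hs ls] := ln_h_omega q1 qp (_ : 0 < s < 1); first by lra.
have [|hz lz] := ln_h_omega q1 qp (_ : 0 < z < 1); first by lra.
have [|/andP[_ wq] _] := omegaP q1 (_ : 0 < s < 1); first by lra.
have [|/andP[w1 _] _] := omegaP q1 (_ : 0 < z < 1); first by lra.
rewrite -ltr_ln ?posrE// ls lz lnh_par_incr ?(ltW w1)//.
exact: omega_decr.
Qed.

Lemma lnh_par1 p q : lnh_par p q 1 = 0.
Proof.
rewrite /lnh_par /hnum /hden /hgap powR1 subrr !mulr0 !add0r mulr1 subKr.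
by rewrite ln1; ring.
Qed.

(** The parametrised [h] is 1 at [w = 1] and blows up as the gap [q - (q-1) w]
    tends to 0. Instead of a limit, an explicit [w1] with [lnh_par w1 >= ln y]
    serves as right end of the interval for the intermediate value theorem. *)
Lemma lnh_par_surj p q y : 1 < q -> q < p ->
  1 < y ->
  exists2 w, 1 < w < q / (q - 1) & lnh_par p q w = ln y.
Proof.
move=> q1 qp y1; set w0 := q / (q - 1).
have w0gt1 : 1 < w0 by rewrite /w0 ltr_pdivlMr; lra.
pose m := w0 `^ (1 - q) `^ p; pose M := hden p q w0 `^ (p - q).
have w0gt0 := lt_trans ltr01 w0gt1.
have m0 : 0 < m by rewrite !powR_gt0.
have B0 : 0 < hden p q w0.
  by rewrite /hden addr_gt0// mulr_gt0// subr_gt0.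
have M0 : 0 < M by rewrite powR_gt0.
(* [e] is the value of the gap at [w1]. As [e < 1] and [q > 1], the gap to the
   power [q] is at most [e], so [m / (e * M)] bounds the parametrised [h] at
   [w1] from below, and it equals [(m + y * M) / M >= y]. *)
pose e := m / (m + y * M).
have yM : 0 < y * M by rewrite mulr_gt0//; lra.
have e0 : 0 < e by rewrite divr_gt0// addr_gt0.
have e1 : e < 1 by rewrite ltr_pdivrMr ?addr_gt0//; lra.
pose w1 := (q - e) / (q - 1).
have dw1 : hgap q w1 = e.
  by rewrite /hgap /w1; field; rewrite gt_eqF//; lra.
have w11 : 1 < w1 by rewrite /w1 ltr_pdivlMr; lra.
have w10 : w1 < w0.
  by rewrite /w1 /w0 ltr_pM2r ?invr_gt0; lra.
have [||w /andP[ww ww1] hw] := @IVT_le _ (lnh_par p q) 1 w1 (ln y) (ltW w11).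
- move=> x /andP[x1 xw]; apply/differentiable_continuous/derivable1_diffP.
  by apply: ex_derive; apply: (is_derive_lnh_par q1 qp); rewrite x1 (le_lt_trans xw).
- left; apply/andP; split.
    by rewrite lnh_par1 ln_ge0// ltW.
  have [A1 B1 d1] : [/\ 0 < hnum p q w1, 0 < hden p q w1 & 0 < hgap q w1].
    by apply: hnum_hden_hgap_gt0 => //; rewrite ltW.
  have mA : ln m <= p * ln (hnum p q w1).
    rewrite -ln_powR ler_ln ?posrE ?powR_gt0//.
    rewrite ge0_ler_powR ?nnegrE ?powR_ge0 ?(ltW A1)//; first by lra.
    have : w0 `^ (1 - q) <= w1 `^ (1 - q).
      rewrite -(opprB q 1) !powRN lef_pV2 ?posrE ?powR_gt0//; last by lra.
      by rewrite ge0_ler_powR ?nnegrE; lra.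
    have : 0 <= (p - q) * (w1 - 1) by rewrite mulr_ge0; lra.
    by rewrite /hnum; lra.
  have dq : q * ln (hgap q w1) <= ln e.
    rewrite dw1 -subr_ge0 (_ : _ - _ = (1 - q) * ln e); last by ring.
    by rewrite mulr_le0 ?ln_le0 ?ltW//; lra.
  have BM : (p - q) * ln (hden p q w1) <= ln M.
    rewrite -ln_powR ler_ln ?posrE ?powR_gt0// ge0_ler_powR ?nnegrE ?ltW ?subr_gt0//.
    by rewrite /hden ltrD// ltr_pM2l ?subr_gt0 ?ltrD2r.
  suff : ln y <= ln m - ln e - ln M by rewrite /lnh_par; lra.
  have me0 : 0 < m / e by rewrite divr_gt0.
  rewrite -ln_div ?posrE// -ln_div ?posrE//.
  rewrite ler_ln ?posrE; [|lra|exact: divr_gt0].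
  rewrite /e invf_div mulrCA divff ?gt_eqF// mulr1.
  by rewrite ler_pdivlMr// lerDr ltW.
exists w; last by [].
rewrite (le_lt_trans ww1 w10) andbT lt_neqAle ww andbT; apply/eqP => w1E.
have : 0 < ln y by rewrite ln_gt0.
by rewrite -hw -w1E lnh_par1 ltxx.
Qed.

Lemma h_surj p q y : 1 < q -> q < p ->
  1 < y -> exists2 s, 0 < s < 1 & h p q s = y.
Proof.
move=> q1 qp y1; have [w /andP[w1 wq] ew] := lnh_par_surj q1 qp y1.
have w1q : 1 <= w <= q / (q - 1) by rewrite !ltW.
have s01 : 0 < H q w < 1.
  apply/andP; split; last by rewrite -(H1 q) H_decr.
  rewrite H_factor; [|lra|lra].
  have [_ _ d0] : [/\ 0 < hnum p q w, 0 < hden p q w & 0 < hgap q w].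
    by apply: hnum_hden_hgap_gt0 => //; rewrite ltW.
  by rewrite mulr_gt0 ?powR_gt0//; lra.
exists (H q w) => //; have [h0 lh] := ln_h_omega q1 qp s01.
by apply: ln_inj; rewrite ?posrE// ?lh ?HK//; lra.
Qed.

End HOfOmega.

(** * The number [t(0)] *)

Section T0.
Context {R : realType}.
Implicit Types (p q r s t x y z : R).

Lemma one_powR r : (1 : R) `^ r = 1.
Proof. by rewrite powR1. Qed.

Lemma ltr_powRr r x y : 0 < r -> 0 <= x -> 0 <= y ->
  (x `^ r < y `^ r) = (x < y).
Proof.
move=> r0 x0 y0; case: (ltP x y) => [|yx]; first exact: gt0_ltr_powR.
by apply/negbTE; rewrite -leNgt ge0_ler_powR ?nnegrE// ltW.
Qed.

Lemma powR_gt1 x r : 1 < x -> 0 < r -> 1 < x `^ r.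
Proof.
by move=> x1 r0; rewrite -[ltLHS](one_powR r) ltr_powRr// ltW// (lt_trans ltr01).
Qed.

(** The derivative is [p * x^(r-1) * (x^(p-r) - 1)], positive for [x > 1]. *)
Lemma t0_fun_incr p r y z : 0 < r -> r < p -> 1 <= y -> y < z ->
  y `^ p - p / r * y `^ r < z `^ p - p / r * z `^ r.
Proof.
move=> r0 rp y1 yz.
apply: (@is_derive_lt _ (fun x => x `^ p - p / r * x `^ r)
  (fun x => p * x `^ (p - 1) - p / r * (r * x `^ (r - 1)))) => // x /andP[yx xz].
  have x0 : 0 < x by lra.
  exact: is_deriveB (is_derive1_powR p x0)
    (is_deriveZ (p / r) (is_derive1_powR r x0)).
have x1 : 1 < x by lra.
have x0 : 0 < x by lra.
have -> : x `^ (p - 1) = x `^ (p - r) * x `^ (r - 1).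
  by rewrite -powRD ?(gt_eqF x0) ?implybT//; congr (_ `^ _); ring.
rewrite (_ : _ - _ = p * (x `^ (r - 1) * (x `^ (p - r) - 1))); last first.
  by field; rewrite gt_eqF.
by rewrite !mulr_gt0 ?powR_gt0 ?subr_gt0 ?powR_gt1 ?subr_gt0//; lra.
Qed.

Lemma t0_fun_lt p r y z : 0 < r -> r < p -> 1 <= y -> 1 <= z ->
  (y `^ p - p / r * y `^ r < z `^ p - p / r * z `^ r) = (y < z).
Proof.
move=> r0 rp y1 z1; case: (ltgtP y z) => [yz|zy|->]; last by rewrite ltxx.
  exact: t0_fun_incr.
by apply/negbTE; rewrite -leNgt ltW// t0_fun_incr.
Qed.

(** Let [r = s1 / s2] and [al = (p-1) / (p-q)]. The hypothesis says that
    [r^(p-1) <= s1^(p-q)], that is [r^al <= s1]. Young's inequality for the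
    product [r * 1] and the exponents [al], [al / (al-1)] gives
    [al * r <= r^al + (al - 1)], and [r <= 1] accounts for the rest. *)
Lemma D_bound p q (s1 s2 : R) : 1 < q -> q < p -> 0 < s1 -> s1 < 1 -> 0 < s2 ->
  s1 `^ (q - 1) <= s2 `^ (p - 1) -> p * (s1 / s2) <= (p - q) * s1 + q.
Proof.
move=> q1 qp s10 s11 s20 s12.
set r := s1 / s2; have r0 : 0 < r by rewrite divr_gt0.
have rp : r `^ (p - 1) <= s1 `^ (p - q).
  have e : s1 `^ (p - 1) = s1 `^ (p - q) * s1 `^ (q - 1).
    by rewrite -powRD ?(gt_eqF s10) ?implybT//; congr (_ `^ _); ring.
  rewrite -(@ler_pM2r _ (s2 `^ (p - 1))) ?powR_gt0// -powRM ?(ltW r0) ?(ltW s20)//.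
  by rewrite /r divfK ?gt_eqF// e ler_pM2l ?powR_gt0.
have r1 : r <= 1.
  rewrite leNgt; apply/negP => r1.
  have : 1 < r `^ (p - 1) by rewrite powR_gt1//; lra.
  apply/negP; rewrite -leNgt (le_trans rp)// -[leRHS](one_powR (p - q)).
  by rewrite ge0_ler_powR ?nnegrE//; lra.
pose al := (p - 1) / (p - q).
have al1 : 1 < al by rewrite /al ltr_pdivlMr; lra.
have ral : r `^ al <= s1.
  rewrite /al powRrM -[leRHS](powRr1 (ltW s10)).
  rewrite -[in leRHS](@mulfV _ (p - q)); last by rewrite gt_eqF//; lra.
  by rewrite powRrM ge0_ler_powR ?nnegrE ?powR_ge0// invr_ge0; lra.
have alE : (p - q) * al = p - 1.
  by rewrite /al mulrC divfK// gt_eqF//; lra.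
clearbody al.
have al0 : 0 < al by lra.
have be0 : 0 < al / (al - 1) by rewrite divr_gt0; lra.
have alN : al != 0 by rewrite gt_eqF.
have conj : al^-1 + (al / (al - 1))^-1 = 1.
  by field; rewrite alN gt_eqF//; lra.
have young := conjugate_powR (ltW r0) ler01 al0 be0 conj.
have {}young : al * r <= s1 + (al - 1).
  rewrite (le_trans (_ : _ <= r `^ al + (al - 1))) ?lerD2r//.
  rewrite mulrC -ler_pdivlMr//.
  rewrite mulr1 one_powR in young; apply: le_trans young _.
  by rewrite le_eqVlt; apply/orP; left; apply/eqP; field; rewrite alN gt_eqF//; lra.
have c0 : 0 < p - q by lra.
have : (p - q) * (al * r) <= (p - q) * (s1 + (al - 1)) by rewrite ler_pM2l.
by rewrite mulrA alE !mulrDr alE; lra.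
Qed.

(** [D_bound] says that the prescribed value is at least the value at 1 of the
    defining function of [t(0)], so the intermediate value theorem applies. *)
Lemma t0P p q (s1 s2 : R) : 1 < q -> q < p -> 0 < s1 -> s1 < 1 -> 0 < s2 ->
  s1 `^ (q - 1) <= s2 `^ (p - 1) -> let t := t0 p q s1 s2 in
  1 <= t /\
  t `^ p - p / (p - q) * t `^ (p - q) = s1 - p / (p - q) * (s1 / s2).
Proof.
move=> q1 qp s10 s11 s20 s12 /=; set v := s1 - _.
pose g y : R := y `^ p - p / (p - q) * y `^ (p - q).
suff [y y1 gy] : exists2 y, 1 <= y & g y = v.
  by apply: (@xgetPex _ 1 [set y | 1 <= y /\ g y = v]); exists y.
have pc0 : 0 < p / (p - q) by rewrite divr_gt0; lra.
have r0 : 0 < s1 / s2 by rewrite divr_gt0.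
(* [b] solves [b^q - p / (p - q) = 1], whence [g b = b^(p-q) > 1 > v]. *)
pose b := (1 + p / (p - q)) `^ q^-1.
have b1 : 1 < b by rewrite powR_gt1 ?invr_gt0//; lra.
have bq : b `^ q = 1 + p / (p - q).
  by rewrite -powRrM mulVf ?powRr1// ?gt_eqF//; lra.
have [||y /andP[y1 _] gy] := @IVT_le _ g 1 b v (ltW b1); last by exists y.
- move=> x /andP[x1 _]; apply/differentiable_continuous/derivable1_diffP.
  have x0 : 0 < x by lra.
  have dg : is_derive x 1 g _ := is_deriveB (is_derive1_powR p x0)
    (is_deriveZ (p / (p - q)) (is_derive1_powR (p - q) x0)).
  exact: ex_derive.
left; apply/andP; split.
  rewrite /g !powR1 mulr1 /v.
  rewrite -(@ler_pM2l _ (p - q)); last by lra.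
  have := D_bound q1 qp s10 s11 s20 s12.
  rewrite !mulrBr !mulrA [(p - q) * p / _]mulrAC mulfV; last by rewrite gt_eqF//; lra.
  by lra.
have -> : g b = b `^ (p - q).
  rewrite /g; have {1}-> : p = (p - q) + q by ring.
  by rewrite powRD ?bq; [ring | rewrite (gt_eqF (lt_trans ltr01 b1)) implybT].
have := powR_gt1 b1 (_ : 0 < p - q); rewrite subr_gt0 => /(_ qp).
have : 0 < p / (p - q) * (s1 / s2) by rewrite mulr_gt0.
by rewrite /v; lra.
Qed.

(** Apart from the case [s1 * A' < 1], where both sides are true, this compares
    the two sides through the function defining [t(0)], evaluated at [t(0)] and
    at the [(p-q)]-th root of [s1 * A'], with
    [A' = (p - q) / q * a q s2 + s2^-1]. *)
Lemma t0_gt_iff p q (s1 s2 : R) : 1 < q -> q < p ->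
  0 < s1 < 1 -> 0 < s2 < 1 -> s1 `^ (q - 1) <= s2 `^ (p - 1) ->
  ((p - q) / q * s1 * a q s2 + s1 / s2 < t0 p q s1 s2 `^ (p - q))
  = (h p q s2 < 1 / s1 `^ q).
Proof.
move=> q1 qp /andP[s10 s11] s2i s12; have /andP[s20 s21] := s2i.
have [t1 tE] := t0P q1 qp s10 s11 s20 s12; set t := t0 p q s1 s2 in t1 tE *.
pose A' := (p - q) / q * a q s2 + s2^-1; pose B' := p / q * a q s2 + 1.
have c0 : 0 < p - q by lra.
have [A0 B0 AB] : [/\ 0 < A', 0 < B' & A' <= B'].
  have [w1 _] := omegaP q1 s2i; have [eA eB] := coef_omega q1 qp s2i.
  have [hA0 hB0 hd0] : [/\ 0 < hnum p q (omega q s2), 0 < hden p q (omega q s2)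
      & 0 < hgap q (omega q s2)].
    by apply: hnum_hden_hgap_gt0 => //; case/andP: w1 => /ltW -> ->.
  rewrite /A' /B' eA eB !divr_gt0//; split => //.
  (* Over the common denominator, [A' <= B'] reduces to [w^(1-q) <= w]. *)
  rewrite ler_pM2r ?invr_gt0// /hnum /hden lerD2l.
  rewrite -[leRHS]powRr1; last by lra.
  by apply: ler_powR; lra.
have -> : (p - q) / q * s1 * a q s2 + s1 / s2 = s1 * A' by rewrite /A'; ring.
have -> : (h p q s2 < 1 / s1 `^ q) = ((s1 * A') `^ p < (s1 * B') `^ (p - q)).
  rewrite /h -/A' -/B' !powRM ?ltW// ltr_pdivrMr ?powR_gt0// mulrAC.
  rewrite ltr_pdivlMr ?powR_gt0// mul1r.
  have -> : s1 `^ p = s1 `^ (p - q) * s1 `^ q.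
    by rewrite -powRD ?(gt_eqF s10) ?implybT//; congr (_ `^ _); ring.
  by rewrite -mulrA ltr_pM2l ?powR_gt0// mulrC.
have X0 : 0 < s1 * A' by rewrite mulr_gt0.
have [X1|X1] := ltP (s1 * A') 1.
  rewrite (lt_le_trans X1); last first.
    rewrite -[leLHS](one_powR (p - q)) ge0_ler_powR ?nnegrE//; lra.
  apply/esym; have XB : s1 * A' <= s1 * B' by rewrite ler_pM2l.
  have e : (s1 * A') `^ p = (s1 * A') `^ (p - q) * (s1 * A') `^ q.
    by rewrite -powRD ?(gt_eqF X0) ?implybT//; congr (_ `^ _); ring.
  have Xq : (s1 * A') `^ q < 1.
    by rewrite -[ltRHS](one_powR q) ltr_powRr ?(ltW X0)//; lra.
  rewrite e (lt_le_trans (_ : _ < (s1 * A') `^ (p - q)))//.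
    by rewrite gtr_pMr ?powR_gt0.
  have := le_trans (ltW X0) XB => XB0.
  by rewrite ge0_ler_powR ?nnegrE ?(ltW X0) ?(ltW c0).
pose z := (s1 * A') `^ (p - q)^-1.
have z1 : 1 <= z.
  by rewrite -[leLHS](one_powR (p - q)^-1) ge0_ler_powR ?nnegrE ?invr_ge0
    ?(ltW c0) ?(ltW X0).
have zc : z `^ (p - q) = s1 * A'.
  by rewrite -powRrM mulVf ?powRr1 ?(ltW X0) ?gt_eqF.
clearbody z.
have zp : (s1 * A') `^ p = z `^ p `^ (p - q).
  by rewrite -zc -2!powRrM [p * _]mulrC.
have [z0 t00] : 0 <= z /\ 0 <= t by split; lra.
rewrite zp -{1}zc !ltr_powRr ?powR_ge0 ?mulr_ge0 ?(ltW s10) ?(ltW B0)//.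
rewrite -(@t0_fun_lt p (p - q))//; last by lra.
rewrite tE zc -subr_gt0 -[RHS]subr_gt0; congr (0 < _).
rewrite /A' /B'; field; rewrite !gt_eqF//; lra.
Qed.

End T0.

(** * The inverse of [h] and the equivalence *)

Section Inverse.
Context {R : realType}.
Implicit Types (p q s y z : R).

Lemma hinvP p q y : 1 < q -> q < p -> 1 < y ->
  0 < hinv p q y < 1 /\ h p q (hinv p q y) = y.
Proof.
move=> q1 qp y1; have [s s01 hs] := h_surj q1 qp y1.
have sI : s \in `]0, 1[%classic by rewrite inE/= in_itv.
rewrite -hs /hinv pinvKV// => x z; rewrite !inE/= !in_itv/=.
move=> /andP[x0 x1] /andP[z0 z1] xz.
apply/eqP; case: ltgtP => // lt; exfalso.
  by have := h_decr q1 qp x0 lt z1; rewrite xz ltxx.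
by have := h_decr q1 qp z0 lt x1; rewrite xz ltxx.
Qed.

Lemma hinv_lt p q y z : 1 < q -> q < p -> 1 < y -> 0 < z < 1 ->
  (hinv p q y < z) = (h p q z < y).
Proof.
move=> q1 qp y1 /andP[z0 z1]; have [/andP[i0 i1] hi] := hinvP q1 qp y1.
case: ltgtP => [iz|zi|<-]; last by rewrite hi ltxx.
  by rewrite -hi h_decr.
by apply/esym/negbTE; rewrite -leNgt -hi ltW// h_decr.
Qed.

End Inverse.

Theorem theorem3p3 (R : realType) (p q : R) (hq : 1 < q) (hqp : q < p) :
  [/\ (forall x y : R, 0 < x -> x < y -> y < 1 -> h p q y < h p q x),
      (forall s1 : R, 0 < s1 -> s1 < 1 ->
         exists! s : R, (0 < s < 1) /\ h p q s = 1 / s1 `^ q) &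
      (forall s1 s2 : R, D p q (s1, s2) ->
         forall t : R -> R, is_t p q s1 s2 t ->
           (rderive0 t < 0 <-> hinv p q (1 / s1 `^ q) < s2))].
Proof.
have level_gt1 (s1 : R) : 0 < s1 -> s1 < 1 -> 1 < 1 / s1 `^ q.
  move=> s10 s11; rewrite ltr_pdivlMr ?powR_gt0// mul1r -[ltRHS](one_powR q).
  by rewrite ltr_powRr//; lra.
split.
- by move=> x y x0 xy y1; exact: h_decr.
- move=> s1 s10 s11; have y1 := level_gt1 _ s10 s11.
  have [i01 hi] := hinvP hq hqp y1; exists (hinv p q (1 / s1 `^ q)).
  split=> // s [/andP[s0 s_lt1] hs]; have /andP[i0 i1] := i01.
  apply/eqP; case: ltgtP => // lt; exfalso.
    by have := h_decr hq hqp i0 lt s_lt1; rewrite hi hs ltxx.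
  by have := h_decr hq hqp s0 lt i1; rewrite hi hs ltxx.
- move=> s1 s2 [/= s10 s20 _ s12 s2p] t [_ _ slope].
  have s21 : s2 < 1.
    by rewrite -(@ltr_powRr _ (p - 1)) ?one_powR//; lra.
  have s11 : s1 < 1.
    rewrite -(@ltr_powRr _ (q - 1)) ?one_powR//; [|lra|lra].
    exact: le_lt_trans s2p.
  have s2i : 0 < s2 < 1 by rewrite s20.
  have s1i : 0 < s1 < 1 by rewrite s10.
  rewrite hinv_lt ?level_gt1// -t0_gt_iff// -sgr_lt0 slope.
  rewrite /t0_slope_sign sgr_lt0.
  rewrite (_ : - q * _ - _ + _ = q * ((p - q) / q * s1 * a q s2 + s1 / s2
      - t0 p q s1 s2 `^ (p - q))); last first.
    by rewrite /a; field; rewrite !gt_eqF//; lra.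
  by rewrite pmulr_rlt0 ?subr_lt0//; lra.
Qed.
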